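(* As formal power series in $q$ (with coefficients rational functions in $x$, in fact Laurent polynomials), $$\sum_{\lambda\in \mathcal{SC}} x^{n_1(\lambda)} \, q^{\vert\lambda\vert}= (-q;q^2)_{\infty}\left[\Big(1-\frac1x\Big)\sum_{n\geq0}\frac{(x^2-1)^nq^{2n^2+n}}{(q^2;q^2)_n(-q;q^2)_{n+1}}+\frac1x\sum_{n\geq0}\frac{(x^2-1)^nq^{2n^2-n}}{(q^2;q^2)_n(-q;q^2)_n}\right].$$
   Context: A partition is self-conjugate if its Young diagram is symmetric about the main diagonal; $\mathcal{SC}$ is the set of all self-conjugate partitions (including the empty partition of size $0$), and $|\lambda|$ is the size. The hook length of the cell $(i,j)$ is the number of cells to its right in row $i$ plus the number below it in column $j$ plus $1$; $n_1(\lambda)$ is the number of cells of $\lambda$ with hook length $1$. The $q$-Pochhammer symbol is $(a;q)_0=1$, $(a;q)_n=\prod_{j=0}^{n-1}(1-aq^j)$, $(a;q)_\infty=\prod_{j\ge0}(1-aq^j)$. *)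

(* Defs.v *)
From HB Require Import structures.
From mathcomp Require Import all_boot all_order all_algebra.
Set Implicit Arguments. Unset Strict Implicit. Unset Printing Implicit Defensive.
Import Order.TTheory GRing.Theory Num.Theory.
Local Open Scope ring_scope.

Definition is_partition (s : seq nat) : bool :=
  sorted geq s && all (fun p => 0 < p)%N s.

Definition conj_part (s : seq nat) : seq nat :=
  mkseq (fun j => count (fun p => j < p)%N s) (foldr maxn 0%N s).

Definition self_conjugate (s : seq nat) : bool :=
  is_partition s && (conj_part s == s).

Definition hook (s : seq nat) (i j : nat) : nat :=
  ((nth 0 s i - j.+1) + (nth 0 (conj_part s) j - i.+1)).+1.

Definition n1 (s : seq nat) : nat :=
  \sum_(i < size s) \sum_(j < nth 0%N s i) (hook s i j == 1%N).

(* Every partition of N has at most N parts, each at most N; it is encoded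
   uniquely by a nonincreasing function 'I_N -> 'I_N.+1 (padded with 0s). *)
Definition ptn_of N (f : {ffun 'I_N -> 'I_N.+1}) : seq nat :=
  [seq (f i : nat) | i <- enum 'I_N & (0 < f i)%N].

Definition padded_ok N (f : {ffun 'I_N -> 'I_N.+1}) : bool :=
  sorted geq [seq (f i : nat) | i <- enum 'I_N].

Definition fps (R : Type) := nat -> R.

Section FPS.
Variable R : comUnitRingType.

Definition fps_of_poly (p : {poly R}) : fps R := fun n => p`_n.
Definition fps_add (f g : fps R) : fps R := fun n => f n + g n.
Definition fps_scale (c : R) (f : fps R) : fps R := fun n => c * f n.
Definition fps_mul (f g : fps R) : fps R :=
  fun n => \sum_(i < n.+1) f i * g (n - i)%N.

Fixpoint inv_coefs (f : fps R) (n : nat) : seq R :=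
  match n with
  | 0 => [:: (f 0%N)^-1]
  | m.+1 => let s := inv_coefs f m in
      rcons s (- (f 0%N)^-1 * \sum_(i < m.+1) f i.+1 * nth 0 s (m - i)%N)
  end.
Definition fps_inv (f : fps R) : fps R := fun n => nth 0 (inv_coefs f n) n.
Definition fps_div (f g : fps R) : fps R := fps_mul f (fps_inv g).

(* Infinite sum sum_{n>=0} T n, for a family where T n has q-adic order >= n
   (as is the case in the theorem): coefficient N only involves n <= N. *)
Definition fps_suminf (T : nat -> fps R) : fps R :=
  fun N => \sum_(n < N.+1) T n N.

Definition qpoch (a : {poly R}) (k n : nat) : {poly R} :=
  \prod_(j < n) (1 - a * 'X^(k * j)).

(* (a; q^k)_oo for a with zero constant term and k >= 1: the j-th factor is
   1 + O(q^{j+1}), so coefficient N of the infinite product equals that of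
   the finite product over j <= N. *)
Definition qpoch_inf (a : {poly R}) (k : nat) : fps R :=
  fun N => (qpoch a k N.+1)`_N.
End FPS.

Definition QX := {fraction {poly rat}}.
Definition xvar : QX := FracField.tofrac 'X.

Definition sc_series (x : QX) : fps QX :=
  fun N => \sum_(f : {ffun 'I_N -> 'I_N.+1} |
                   padded_ok f && self_conjugate (ptn_of f) && (sumn (ptn_of f) == N))
             x ^+ n1 (ptn_of f).

(* Main.v *)
Require Import Defs.
From Corelib Require Import Setoid Morphisms.
From HB Require Import structures.
From mathcomp Require Import all_boot all_order all_algebra.
From mathcomp Require Import zify ring.
Set Implicit Arguments.
Unset Strict Implicit.
Import Order.TTheory GRing.Theory Num.Theory.
Local Open Scope ring_scope.

(* A self-conjugate partition is a nest of symmetric hooks with arms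
   a_1 > a_2 > ... >= 0. Adding an outer hook of arm M creates two new corners,
   none if the previous outer arm is M - 1, and one if the hook is a single
   cell. Hence, with z = x^2 - 1, the generating polynomials T_M of the
   self-conjugate partitions with at most M parts satisfy
     T_(M+2) = (1 + q^(2M+3)) T_(M+1) + z q^(2M+3) T_M.
   On the other side, the series
     J_k = sum_n z^n q^(2kn+2n^2-n) / (q^2;q^2)_n * (-q^(2(k+n)+1);q^2)_oo
   satisfy, term by term,
     J_k = (1 + q^(2k+1)) J_(k+1) + z q^(2k+1) J_(k+2),
   and J_k tends to 1. The two recurrences are adjoint: the quantity
     T_(M+1) (J_(M+1) + z J_(M+2)) + z T_M (J_(M+1) - J_(M+2))
   does not depend on M. It equals x^2 ((1 - 1/x) J_1 + (1/x) J_0) at M = 0 and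
   tends to x^2 times the limit of T_M. *)

(** * Self-conjugate partitions and symmetric hooks *)

Lemma nth_conj_part (s : seq nat) (j : nat) :
  nth 0%N (conj_part s) j = count (fun p => j < p)%N s.
Proof.
rewrite /conj_part; have [lt_j|le_j] := ltnP j (foldr maxn 0%N s).
  by rewrite nth_mkseq.
rewrite nth_default ?size_mkseq //; apply/esym/eqP.
rewrite -leqn0 leqNgt -has_count; apply/hasPn => p.
elim: s le_j => //= a s IHs; rewrite geq_max => /andP[le_a le_s].
by rewrite inE => /orP[/eqP->|/(IHs le_s)//]; rewrite -leqNgt.
Qed.

(** In a nonincreasing list the entries exceeding [j] form a prefix, so counting them amounts to
    locating where the prefix ends. *)
Lemma ltn_count_sorted (s : seq nat) (i j : nat) :
  sorted geq s -> (i < count (fun p => j < p)%N s)%N = (j < nth 0%N s i)%N.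
Proof.
elim: s i => [|a s IHs] i /=; first by rewrite nth_nil.
move=> s_sorted; have /IHs {}IHs := path_sorted s_sorted.
case: i => [|i] /=; last first.
  have [_|le_a] := ltnP j a; first by rewrite add1n ltnS IHs.
  rewrite add0n -(IHs i); have -> : count (fun p => j < p)%N s = 0%N; last by [].
  apply/eqP; rewrite -leqn0 leqNgt -has_count; apply/hasPn => p p_s.
  have geq_trans : transitive geq by move=> y x z /= ? /leq_trans; apply.
  have /allP/(_ _ p_s)/= := order_path_min geq_trans s_sorted.
  by move=> /leq_trans/(_ le_a); rewrite -leqNgt.
have [//|le_a] := ltnP j a; rewrite add0n (IHs 0%N).
case: s s_sorted {IHs} => //= b s /andP[/= le_ba _].
by apply/negbTE; rewrite -leqNgt; apply: leq_trans le_a.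
Qed.

Lemma nth_gt0_size (s : seq nat) (i : nat) :
  all (fun p => 0 < p)%N s -> (0 < nth 0 s i)%N = (i < size s)%N.
Proof.
move=> /allP s_pos; have [lt_i|le_i] := ltnP i (size s).
  exact/s_pos/mem_nth.
by rewrite nth_default.
Qed.

(** [j < nth 0 s i] says that the cell [(i, j)] lies in the diagram. The default value 0 makes this
    correct for all [i] and [j], so conjugation becomes plain symmetry in the two indices. *)
Lemma self_conjugateP (s : seq nat) :
  reflect (is_partition s /\
           forall i j, (j < nth 0 s i)%N = (i < nth 0 s j)%N)
          (self_conjugate s).
Proof.
apply: (iffP andP) => -[s_part].
  move=> /eqP s_conj; split=> // i j; rewrite -{2}s_conj nth_conj_part.
  by have /andP[s_sorted _] := s_part; rewrite ltn_count_sorted.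
move=> s_sym; split=> //; have /andP[s_sorted /allP s_pos] := s_part.
have conjE j : nth 0%N (conj_part s) j = nth 0%N s j.
  rewrite nth_conj_part; apply/eqP; rewrite eqn_leq.
  rewrite leqNgt ltn_count_sorted // s_sym ltnn /=.
  by rewrite leqNgt -s_sym -ltn_count_sorted // ltnn.
have c_pos : all (fun p => 0 < p)%N (conj_part s).
  apply/(all_nthP 0%N) => j; rewrite size_mkseq nth_conj_part -has_count.
  elim: s {s_part s_sym s_sorted s_pos conjE} => //= a s IHs.
  by rewrite leq_max => /orP[->//|/IHs ->]; rewrite orbT.
have size_conj : size (conj_part s) = size s.
  have {}s_pos : all (fun p => 0 < p)%N s by apply/allP.
  apply/eqP; rewrite eqn_leq; apply/andP; split; rewrite leqNgt.
    by rewrite -(nth_gt0_size _ c_pos) conjE nth_default.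
  by rewrite -(nth_gt0_size _ s_pos) -conjE nth_default.
by apply/eqP/(@eq_from_nth _ 0%N) => [|j _].
Qed.

Lemma size_self_conjugate (s : seq nat) :
  self_conjugate s -> size s = nth 0%N s 0.
Proof.
move=> /self_conjugateP[/andP[_ s_pos] s_sym].
apply/eqP; rewrite eqn_leq; apply/andP; split; rewrite leqNgt.
  by rewrite -(nth_gt0_size _ s_pos) -s_sym ltnn.
by rewrite s_sym nth_gt0_size // ltnn.
Qed.

(** The diagram of [s] is moved one step down the diagonal and surrounded by a hook with arm and leg
    [a]; the trailing ones are the leg cells below the rows of [s]. This makes sense when
    [size s <= a]. *)
Definition add_hook (a : nat) (s : seq nat) : seq nat :=
  a.+1 :: map S s ++ nseq (a - size s) 1%N.

Section AddHook.
Variables (a : nat) (s : seq nat).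
Hypothesis le_sa : (size s <= a)%N.

Lemma size_add_hook : size (add_hook a s) = a.+1.
Proof. by rewrite /add_hook /= size_cat size_map size_nseq subnKC. Qed.

Lemma nth_add_hook0 : nth 0%N (add_hook a s) 0 = a.+1.
Proof. by []. Qed.

Lemma nth_add_hook (i : nat) :
  nth 0%N (add_hook a s) i.+1 = if (i < a)%N then (nth 0%N s i).+1 else 0%N.
Proof.
rewrite /add_hook /= nth_cat size_map.
have [lt_i|le_i] := ltnP i (size s).
  by rewrite (nth_map 0%N) // (leq_trans lt_i).
by rewrite nth_nseq ltn_sub2rE // (nth_default _ le_i).
Qed.

Lemma sumn_add_hook : sumn (add_hook a s) = (sumn s + (2 * a).+1)%N.
Proof.
rewrite /add_hook /= sumn_cat sumn_nseq mul1n.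
suff -> : sumn (map S s) = (sumn s + size s)%N by lia.
by elim: (s) => //= b t ->; lia.
Qed.

End AddHook.

Lemma sorted_geq_nth (s : seq nat) :
  (forall i, (nth 0 s i.+1 <= nth 0 s i)%N) -> sorted geq s.
Proof. by move=> s_noninc; apply/(sortedP 0%N) => i _; apply: s_noninc. Qed.

Lemma nth_sorted_geq (s : seq nat) (i j : nat) :
  sorted geq s -> (i <= j)%N -> (nth 0 s j <= nth 0 s i)%N.
Proof.
move=> s_sorted le_ij; have [lt_j|le_j] := ltnP j (size s).
  have geq_trans : transitive geq by move=> y x z /= ? /leq_trans; apply.
  have geq_refl : reflexive geq by move=> x; apply: leqnn.
  apply: (sorted_leq_nth geq_trans geq_refl) => //.
  exact: leq_ltn_trans lt_j.
by rewrite (nth_default _ le_j).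
Qed.

Lemma self_conjugate_add_hook (a : nat) (s : seq nat) :
  (size s <= a)%N -> self_conjugate s -> self_conjugate (add_hook a s).
Proof.
move=> le_sa s_sc; have s_size := size_self_conjugate s_sc.
have /self_conjugateP[/andP[s_sorted s_pos] s_sym] := s_sc.
apply/self_conjugateP; split.
  apply/andP; split; last first.
    by rewrite /add_hook /= all_cat all_nseq orbT andbT all_map; apply/allP.
  apply: sorted_geq_nth => -[|i].
    rewrite nth_add_hook // nth_add_hook0.
    by case: ifP => // _; rewrite ltnS -s_size.
  rewrite !nth_add_hook //; case: ifP => // lt_i.
  by rewrite (ltn_trans _ lt_i) // ltnS nth_sorted_geq.
have le_nth i : (nth 0 s i <= a)%N.
  by rewrite (leq_trans (nth_sorted_geq s_sorted (leq0n i))) // -s_size.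
move=> [|i] [|j] //; rewrite ?nth_add_hook // ?nth_add_hook0.
- by rewrite ltnS; case: ifP => //.
- by rewrite ltnS; case: ifP => //.
have [lt_i|le_i] := ltnP i a; have [lt_j|le_j] := ltnP j a; rewrite //= ?ltnS.
- by [].
- by have := le_nth i; lia.
by have := le_nth j; lia.
Qed.

Lemma add_hook_surj (s : seq nat) :
  self_conjugate s -> (0 < size s)%N ->
  exists t, [/\ self_conjugate t, (size t <= (size s).-1)%N
              & s = add_hook (size s).-1 t].
Proof.
move=> s_sc s_gt0; have s_size := size_self_conjugate s_sc.
have /self_conjugateP[/andP[s_sorted s_pos] s_sym] := s_sc.
(* The first row and column are removed. Row [i.+1] keeps a cell when its length exceeds 1, which by
   symmetry means [i.+1 < nth 0 s 1]; this gives the length of [t]. *)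
pose t := mkseq (fun i => (nth 0%N s i.+1).-1) (nth 0%N s 1).-1.
have nth_t i : nth 0%N t i = (nth 0%N s i.+1).-1.
  have [lt_i|le_i] := ltnP i (nth 0%N s 1).-1; first by rewrite nth_mkseq.
  rewrite nth_default ?size_mkseq //.
  have : ~~ (1 < nth 0 s i.+1)%N by rewrite s_sym; lia.
  lia.
have t_pos : all (fun p => 0 < p)%N t.
  apply/(all_nthP 0%N) => i; rewrite nth_t size_mkseq => lt_i.
  have : (1 < nth 0 s i.+1)%N by rewrite s_sym; lia.
  lia.
have le_t : (size t <= (size s).-1)%N.
  by rewrite size_mkseq s_size; have := nth_sorted_geq s_sorted (leqnSn 0); lia.
exists t; split=> //.
  apply/self_conjugateP; split.
    rewrite /is_partition t_pos andbT; apply: sorted_geq_nth => i.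
    by rewrite !nth_t; have := nth_sorted_geq s_sorted (leqnSn i.+1); lia.
  by move=> i j; rewrite !nth_t; have := s_sym i.+1 j.+1; lia.
apply: (@eq_from_nth _ 0%N) => [|[|i] lt_i]; rewrite ?size_add_hook ?prednK //.
  by rewrite nth_add_hook0 prednK.
rewrite nth_add_hook // nth_t; have -> : (i < (size s).-1)%N by lia.
by rewrite prednK // nth_gt0_size.
Qed.

(** A cell of hook length 1 ends both its row and its column, and by symmetry column [j] is as long
    as row [j]. The free bound [L] lets [s] be summed over the square left when row 0 and column 0
    of [add_hook a s] are dropped. *)
Lemma n1E (s : seq nat) (L : nat) : self_conjugate s -> (size s <= L)%N ->
  n1 s = (\sum_(i < L) \sum_(j < L)
           ((nth 0 s i == j.+1) && (nth 0 s j == i.+1))%N)%N.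
Proof.
move=> s_sc le_sL; have s_size := size_self_conjugate s_sc.
have /andP[s_part /eqP s_conj] := s_sc.
have /self_conjugateP[/andP[s_sorted s_pos] s_sym] := s_sc.
have -> : n1 s = (\sum_(i < size s) \sum_(j < nth 0 s i) (hook s i j == 1))%N.
  by [].
rewrite (big_ord_widen L
  (fun i => \sum_(j < nth 0 s i) (hook s i j == 1))%N) // [LHS]big_mkcond /=.
apply: eq_bigr => i _; have [lt_i|le_i] := ltnP i (size s); last first.
  by rewrite big1 // => j _; rewrite nth_default.
have le_iL : (nth 0 s i <= L)%N.
  by rewrite leqNgt s_sym nth_default.
rewrite (big_ord_widen _ (fun j => (hook s i j == 1%N) : nat) le_iL).
rewrite [LHS]big_mkcond /=; apply: eq_bigr => j _.
rewrite /hook s_conj; have := s_sym i j.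
case: ltnP => [lt_j lt_ij|le_j _]; last by lia.
by rewrite eqSS addn_eq0 !subn_eq0 !eqn_leq lt_j -lt_ij !andbT.
Qed.

(** Old corners move along the diagonal and stay corners. The ends of the new arm and leg are
    corners exactly when [s] does not reach row and column [a.-1]; for [a = 0] these two ends are
    one cell. *)
Lemma n1_add_hook (a : nat) (s : seq nat) :
  self_conjugate s -> (size s <= a)%N ->
  n1 (add_hook a s) =
    (n1 s + if (size s < a)%N then 2 else if a == 0%N then 1 else 0)%N.
Proof.
move=> s_sc le_sa; have /self_conjugateP[/andP[_ s_pos] _] := s_sc.
rewrite (n1E (L := a.+1)) ?size_add_hook ?self_conjugate_add_hook //.
rewrite (n1E (L := a)) // big_ord_recl big_ord_recl nth_add_hook0.
have nth_lift (i : 'I_a) :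
    nth 0%N (add_hook a s) (lift ord0 i) = (nth 0%N s i).+1.
  by rewrite lift0 nth_add_hook // ltn_ord.
under [X in (_ + X)%N]eq_bigr => i _.
  rewrite big_ord_recl nth_lift nth_add_hook0.
  under eq_bigr => j _ do rewrite nth_lift !lift0 !eqSS.
  over.
rewrite big_split addnA addnC; congr (_ + _)%N.
under [X in (_ + X + _)%N]eq_bigr => j _ do rewrite nth_lift lift0 !eqSS.
under [X in (_ + X)%N]eq_bigr => j _ do rewrite lift0 !eqSS.
case: a le_sa {nth_lift} => [|a] le_sa; first by rewrite !big_ord0 ltn0.
rewrite !big_ord_recr /= !eqxx !andbT /=.
(* Row 0 has length [a.+2], so only its last cell can contribute, and likewise for column 0. *)
rewrite !big1 => [|i _|i _]; last 2 first.
- by rewrite eqSS (gtn_eqF (ltn_ord i)) // andbF.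
- by rewrite eqSS (gtn_eqF (ltn_ord i)).
rewrite !add0n ltnS leqNgt -(nth_gt0_size a s_pos).
by case: (nth 0%N s a).
Qed.

(** * Enumeration of self-conjugate partitions by number of parts *)

Fixpoint sc_le (M : nat) : seq (seq nat) :=
  if M is M'.+1 then sc_le M' ++ map (add_hook M') (sc_le M') else [:: [::]].

(** A partition with exactly [M.+1] parts has an outer hook of arm [M], and removing it leaves at
    most [M] parts. *)
Lemma mem_sc_le (M : nat) (s : seq nat) :
  (s \in sc_le M) = self_conjugate s && (size s <= M)%N.
Proof.
elim: M s => [|M IHM] s /=.
  by rewrite inE; case: s => [|a s]; rewrite ?andbF.
rewrite mem_cat IHM; apply/orP/andP => [[/andP[s_sc le_s]|/mapP[t]]|[s_sc]].
- by split=> //; apply: leqW.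
- rewrite IHM => /andP[t_sc le_t] ->.
  by rewrite size_add_hook // self_conjugate_add_hook.
rewrite leq_eqVlt ltnS s_sc => /orP[/eqP s_size|->]; last by left.
have [|t [t_sc le_t s_eq]] := add_hook_surj s_sc; first by rewrite s_size.
right; apply/mapP; exists t; last by rewrite s_eq s_size.
by rewrite IHM t_sc -[M]/(M.+1.-1) -s_size.
Qed.

Lemma uniq_sc_le (M : nat) : uniq (sc_le M).
Proof.
elim: M => //= M IHM; rewrite cat_uniq IHM /=; apply/andP; split.
  apply/hasPn => _ /mapP[t t_M ->]; rewrite mem_sc_le.
  move: t_M; rewrite mem_sc_le => /andP[_ le_t].
  by rewrite size_add_hook // ltnn andbF.
rewrite map_inj_in_uniq // => s t.
rewrite !mem_sc_le => /andP[s_sc le_s] /andP[t_sc le_t] eq_st.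
have eq_nth i : (i < M)%N -> nth 0%N s i = nth 0%N t i.
  move=> lt_i; have := congr1 (fun u => nth 0%N u i.+1) eq_st.
  by rewrite !nth_add_hook // lt_i => -[].
have eq_size : size s = size t.
  (* The size is the first entry, and entry 0 is covered by [eq_nth] once [M] is positive. *)
  case: (posnP M) => [M0|/eq_nth]; last by rewrite -!size_self_conjugate.
  by move: le_s le_t; rewrite M0 !leqn0 => /eqP-> /eqP->.
apply: (@eq_from_nth _ 0%N) => // i lt_i; apply: eq_nth.
exact: leq_trans le_s.
Qed.

(** * Encoding of partitions by padded functions *)

Lemma nth_filter_gt0 (s : seq nat) (i : nat) : sorted geq s ->
  nth 0%N [seq p <- s | (0 < p)%N] i = nth 0%N s i.
Proof.
elim: s i => //= a s IHs i s_sorted.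
have {IHs} IHs := IHs _ (path_sorted s_sorted).
case: a s_sorted => [|a] s_sorted /=; last by case: i => //=.
have geq_trans : transitive geq by move=> y x z /= ? /leq_trans; apply.
have /all_pred1P/= -> : all (pred1 0%N) s.
  apply: sub_all (order_path_min geq_trans s_sorted) => p /=.
  by rewrite leqn0.
by case: i => [|i] /=; rewrite ?nth_nseq ?if_same;
   elim: (size s) => //= n.
Qed.

Section Encoding.
Variable N : nat.
Implicit Type f : {ffun 'I_N -> 'I_N.+1}.

Lemma ptn_ofE f :
  ptn_of f = [seq p <- [seq (f i : nat) | i <- enum 'I_N] | (0 < p)%N].
Proof. by rewrite filter_map. Qed.

Lemma nth_ptn_of f (i : 'I_N) : padded_ok f -> nth 0%N (ptn_of f) i = f i.
Proof.
move=> f_ok; rewrite ptn_ofE nth_filter_gt0 // (nth_map i) ?size_enum_ord //.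
by rewrite nth_ord_enum.
Qed.

Lemma ptn_of_inj : {in @padded_ok N &, injective (@ptn_of N)}.
Proof.
move=> f g f_ok g_ok eq_fg; apply/ffunP => i; apply: ord_inj.
by rewrite -!nth_ptn_of ?eq_fg.
Qed.

Lemma size_ptn_of f : (size (ptn_of f) <= N)%N.
Proof. by rewrite size_map size_filter -[leqRHS](size_enum_ord N) count_size. Qed.

Lemma ptn_of_surj (s : seq nat) : self_conjugate s -> (size s <= N)%N ->
  exists2 f : {ffun 'I_N -> 'I_N.+1}, padded_ok f & ptn_of f = s.
Proof.
move=> s_sc le_s; have s_size := size_self_conjugate s_sc.
have /self_conjugateP[/andP[s_sorted s_pos] s_sym] := s_sc.
(* Symmetry turns the bound on the number of parts into a bound on the parts, so [inord] below loses
   nothing. *)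
have le_nth i : (nth 0 s i <= N)%N.
  by rewrite leqNgt s_sym nth_default.
pose f : {ffun 'I_N -> 'I_N.+1} := [ffun i : 'I_N => inord (nth 0%N s i)].
have f_seq : [seq (f i : nat) | i <- enum 'I_N] = s ++ nseq (N - size s) 0%N.
  apply: (@eq_from_nth _ 0%N).
    by rewrite size_map size_enum_ord size_cat size_nseq subnKC.
  rewrite size_map size_enum_ord => i lt_i.
  rewrite (nth_map (Ordinal lt_i)) ?size_enum_ord //.
  rewrite ffunE nth_enum_ord // inordK ?ltnS // nth_cat nth_nseq if_same.
  by case: ltnP => // le_i; rewrite nth_default.
have ok : padded_ok f.
  rewrite /padded_ok f_seq; apply: sorted_geq_nth => i.
  rewrite !nth_cat !nth_nseq !if_same.
  case: ltnP => // lt_i; rewrite (ltnW lt_i); exact: nth_sorted_geq.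
exists f => //; rewrite ptn_ofE f_seq filter_cat.
rewrite (all_filterP s_pos) (_ : filter _ (nseq _ _) = [::]) ?cats0 //.
by elim: (N - size s)%N.
Qed.

End Encoding.

Lemma size_le_sumn (s : seq nat) :
  all (fun p => 0 < p)%N s -> (size s <= sumn s)%N.
Proof. by elim: s => //= a s IHs /andP[a_gt0 /IHs]; lia. Qed.

(** A partition of [N] has at most [N] parts, so every list [sc_le M] with [N <= M] contains all
    those that count. *)
Lemma sc_seriesE (x : QX) (N M : nat) : (N <= M)%N ->
  sc_series x N = \sum_(s <- sc_le M | sumn s == N) x ^+ n1 s.
Proof.
move=> le_NM; rewrite /sc_series -big_filter.
rewrite -(big_map (@ptn_of N) xpredT (fun s => x ^+ n1 s)) -[RHS]big_filter.
apply: perm_big; apply: uniq_perm.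
- rewrite map_inj_in_uniq ?filter_uniq ?index_enum_uniq // => f g.
  rewrite !mem_filter => /andP[/andP[/andP[f_ok _] _] _].
  by move=> /andP[/andP[/andP[g_ok _] _] _]; apply: ptn_of_inj.
- exact/filter_uniq/uniq_sc_le.
move=> s; rewrite mem_filter mem_sc_le.
apply/mapP/and3P => [[f]|[/eqP s_sum s_sc le_s]].
  rewrite mem_filter => /andP[/andP[/andP[f_ok f_sc] f_sum] _] ->.
  by rewrite f_sum f_sc (leq_trans (size_ptn_of f)).
have {}le_s : (size s <= N)%N.
  rewrite -s_sum size_le_sumn //.
  by case/self_conjugateP: s_sc => /andP[].
have [f f_ok f_s] := ptn_of_surj s_sc le_s.
by exists f; rewrite ?mem_filter ?f_s ?f_ok ?s_sc ?s_sum ?eqxx ?mem_index_enum.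
Qed.

(** * Power series modulo a power of the variable *)

Section FormalSeries.
Variable R : comUnitRingType.
Implicit Types (p q : {poly R}) (F G : fps R).

(** Congruence modulo ['X^K]. Coefficient [N] of each series is determined modulo ['X^N.+1], so the
    argument takes place among polynomials; the instances below allow rewriting with this congruence
    inside ring expressions. *)
Definition eqmodX (K : nat) p q := forall i, (i < K)%N -> p`_i = q`_i.

#[export] Instance eqmodX_equiv K : Equivalence (eqmodX K).
Proof.
split=> [p i //|p q pq i lt_i|p q r pq qr i lt_i]; first by rewrite pq.
by rewrite pq ?qr.
Qed.

#[export] Instance eqmodX_add K :
  Proper (eqmodX K ==> eqmodX K ==> eqmodX K) (@GRing.add {poly R}).
Proof. by move=> p p' pE q q' qE i lt_i; rewrite !coefD pE ?qE. Qed.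

#[export] Instance eqmodX_opp K :
  Proper (eqmodX K ==> eqmodX K) (@GRing.opp {poly R}).
Proof. by move=> p p' pE i lt_i; rewrite !coefN pE. Qed.

#[export] Instance eqmodX_mul K :
  Proper (eqmodX K ==> eqmodX K ==> eqmodX K) (@GRing.mul {poly R}).
Proof.
move=> p p' pE q q' qE i lt_i; rewrite !coefM; apply: eq_bigr => j _.
by rewrite pE ?qE // ?(leq_ltn_trans (leq_subr _ _)) //; have := ltn_ord j; lia.
Qed.

Lemma eqmodX_sum K (I : finType) (P : pred I) (f g : I -> {poly R}) :
  (forall i, P i -> eqmodX K (f i) (g i)) ->
  eqmodX K (\sum_(i | P i) f i) (\sum_(i | P i) g i).
Proof.
by move=> fg j lt_j; rewrite !coef_sum; apply: eq_bigr => i /fg; apply.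
Qed.

Lemma eqmodX_Xn K m : (K <= m)%N -> eqmodX K 'X^m 0.
Proof. by move=> le_K i lt_i; rewrite coefXn coef0 ltn_eqF //; lia. Qed.

Definition fps_trunc (K : nat) F : {poly R} := \poly_(i < K) F i.

Lemma coef_fps_trunc K F i : (i < K)%N -> (fps_trunc K F)`_i = F i.
Proof. by move=> lt_i; rewrite coef_poly lt_i. Qed.

Lemma fps_mul_trunc K F G i : (i < K)%N ->
  fps_mul F G i = (fps_trunc K F * fps_trunc K G)`_i.
Proof.
move=> lt_i; rewrite coefM; apply: eq_bigr => j _.
by have lt_j := ltn_ord j; rewrite !coef_fps_trunc //; lia.
Qed.

Lemma size_inv_coefs F n : size (inv_coefs F n) = n.+1.
Proof. by elim: n => //= n IHn; rewrite size_rcons IHn. Qed.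

Lemma nth_inv_coefs F n k : (k <= n)%N -> (inv_coefs F n)`_k = fps_inv F k.
Proof.
elim: n => [|n IHn]; first by rewrite leqn0 => /eqP->.
rewrite leq_eqVlt => /orP[/eqP-> //|lt_k].
by rewrite /= nth_rcons size_inv_coefs lt_k IHn.
Qed.

Lemma fps_mul_inv F n : F 0%N \is a GRing.unit ->
  fps_mul F (fps_inv F) n = (n == 0%N)%:R.
Proof.
move=> F_unit; case: n => [|n]; rewrite /fps_mul big_ord_recl.
  by rewrite big_ord0 addr0 /fps_inv /= mulrV.
have -> : fps_inv F n.+1 =
    - (F 0%N)^-1 * \sum_(i < n.+1) F i.+1 * fps_inv F (n - i)%N.
  rewrite {1}/fps_inv /= nth_rcons size_inv_coefs ltnn eqxx; congr (_ * _).
  apply: eq_bigr => i _.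
  by rewrite nth_inv_coefs // leq_subr.
by rewrite mulrA mulrN mulrV // mulN1r addNr.
Qed.

Definition invX (K : nat) p : {poly R} := fps_trunc K (fps_inv (fps_of_poly p)).

Lemma mul_invX K p : p`_0 = 1 -> eqmodX K (p * invX K p) 1.
Proof.
move=> p0 i lt_i; rewrite coef1 -(@fps_mul_inv (fps_of_poly p)); last first.
  by rewrite /fps_of_poly p0 unitr1.
rewrite (fps_mul_trunc _ _ lt_i).
by apply: (@eqmodX_mul K) => // j lt_j; rewrite coef_fps_trunc.
Qed.

Lemma coef_fps_div K p q i : (i < K)%N ->
  fps_div (fps_of_poly p) (fps_of_poly q) i = (p * invX K q)`_i.
Proof.
move=> lt_i; rewrite /fps_div (fps_mul_trunc _ _ lt_i).
by apply: (@eqmodX_mul K) => // j lt_j; rewrite coef_fps_trunc.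
Qed.

Lemma qpochS (a : {poly R}) k n :
  qpoch a k n.+1 = qpoch a k n * (1 - a * 'X^(k * n)).
Proof. by rewrite /qpoch big_ord_recr. Qed.

Lemma coef0_qpoch (a : {poly R}) k n : a`_0 = 0 -> (qpoch a k n)`_0 = 1.
Proof.
move=> a0; elim: n => [|n IHn]; first by rewrite /qpoch big_ord0 coef1.
by rewrite qpochS coef0M IHn coefB coef1 coef0M a0 mul0r subr0 mulr1.
Qed.

Lemma eqmodX_qpoch K m n : (K <= m)%N -> (m <= n)%N ->
  eqmodX K (qpoch (- 'X) 2 n) (qpoch (- 'X) 2 m).
Proof.
move=> le_Km; elim: n => [|n IHn]; first by rewrite leqn0 => /eqP->.
rewrite leq_eqVlt => /orP[/eqP-> //|le_mn].
rewrite qpochS (IHn le_mn) mulNr opprK -exprS (@eqmodX_Xn _ (2 * n).+1).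
  by rewrite addr0 mulr1.
lia.
Qed.
End FormalSeries.

(** * The q-series recurrence *)

Section QSeries.
Variables (R : comUnitRingType) (K : nat).
Implicit Types z p : {poly R}.
Local Notation "p ~ q" := (eqmodX K p q) (at level 70).

(** Represents (-q^(2a+1); q^2)_oo modulo q^K: all factors after the first [K] are congruent to
    1. *)
Definition qtail (a : nat) : {poly R} := qpoch (- 'X^((2 * a).+1)) 2 K.

Lemma qtailS a : qtail a ~ (1 + 'X^((2 * a).+1)) * qtail a.+1.
Proof.
have -> : (1 + 'X^((2 * a).+1)) * qtail a.+1 =
          qpoch (- 'X^((2 * a).+1)) 2 K.+1 :> {poly R}.
  rewrite /qtail /qpoch big_ord_recl muln0 expr0 mulr1 opprK; congr (_ * _).
  apply: eq_bigr => i _; rewrite lift0 !mulNr -!exprD; congr (1 + - - 'X^_).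
  lia.
rewrite qpochS mulNr opprK -exprD (@eqmodX_Xn _ _ (_ + _)); last by lia.
by rewrite addr0 mulr1.
Qed.

Lemma qtail_large a : (K <= a)%N -> qtail a ~ 1.
Proof.
move=> le_Ka; rewrite /qtail; elim: {2}K => [|n IHn].
  by rewrite /qpoch big_ord0.
rewrite qpochS IHn mulNr opprK -exprD (@eqmodX_Xn _ _ (_ + _)); last by lia.
by rewrite addr0 mulr1.
Qed.

Lemma qpoch_qtail n : qpoch (- 'X) 2 n * qtail n ~ qtail 0.
Proof.
elim: n => [|n IHn]; first by rewrite /qpoch big_ord0 mul1r.
by rewrite -IHn (qtailS n) mulrA qpochS mulNr opprK -exprS.
Qed.

Definition qinv (n : nat) : {poly R} := invX K (qpoch 'X^2 2 n).

Lemma mul_qinv n : qpoch 'X^2 2 n * qinv n ~ 1.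
Proof. by apply/mul_invX/coef0_qpoch; rewrite coefXn. Qed.

Lemma qinvS n : qinv n ~ (1 - 'X^(2 * n.+1)) * qinv n.+1.
Proof.
transitivity (qinv n * (qpoch 'X^2 2 n.+1 * qinv n.+1)).
  by rewrite mul_qinv mulr1.
rewrite qpochS -exprD -mulnS.
rewrite (_ : _ * _ = qpoch 'X^2 2 n * qinv n *
  ((1 - 'X^(2 * n.+1)) * qinv n.+1)); last by ring.
by rewrite mul_qinv mul1r.
Qed.

Lemma qinv0 : qinv 0 ~ 1.
Proof. by have := mul_qinv 0; rewrite {1}/qpoch big_ord0 mul1r. Qed.

Lemma qpoch_inf_qtail (i : nat) : (i < K)%N ->
  qpoch_inf (- 'X) 2 i = (qtail 0)`_i.
Proof.
by move=> lt_i; rewrite /qpoch_inf -(@eqmodX_qpoch R i.+1 _ K).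
Qed.

(** The finite product (-q; q^2)_(n+c) in the denominator cancels the first [n + c] factors of the
    infinite product, which leaves a tail. This turns the terms of the theorem into those of J_c. *)
Lemma qtail_invX (n c : nat) :
  qtail 0 * invX K (qpoch 'X^2 2 n * qpoch (- 'X) 2 (n + c)) ~
  qinv n * qtail (c + n).
Proof.
set g := qpoch _ _ _ * _.
have g0 : g`_0 = 1.
  by rewrite coef0M !coef0_qpoch ?mulr1 // ?coefN ?coefX ?coefXn ?oppr0.
transitivity (g * invX K g * (qinv n * qtail (c + n))).
  rewrite -(@qpoch_qtail (n + c)) [(c + n)%N]addnC /g.
  set u := invX _ _; set p := qpoch _ _ n; set q := qpoch _ _ (n + c).
  rewrite (_ : p * q * u * _ = p * qinv n *
    (q * qtail (n + c) * u)); last by ring.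
  by rewrite mul_qinv mul1r.
by rewrite mul_invX // mul1r.
Qed.

(* [jterm z k n] is the term of index [n], with [q = 'X] and [t = 'X^(2 * k)], of
   [sum_n z^n t^n q^(2n^2-n) / (q^2;q^2)_n * (-t q^(2n+1); q^2)_oo]. *)
Definition jterm z (k n : nat) : {poly R} :=
  z ^+ n * 'X^(2 * k * n + (2 * n ^ 2 - n)) * qinv n * qtail (k + n).

Lemma jterm0 z k : jterm z k 0 ~ (1 + 'X^((2 * k).+1)) * jterm z k.+1 0.
Proof. by rewrite /jterm !addn0 qtailS !muln0 mulrCA. Qed.

(** With C = q^(2k+1) and B = q^(2n+2), everything rests on 1 + CB = (1 + C)B + (1 - B). The left
    side is the factor split off the tail; 1 - B lowers the index of 1/(q^2; q^2)_(n+1) to [n]. *)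
Lemma jtermS z k n : jterm z k n.+1 ~
  (1 + 'X^((2 * k).+1)) * jterm z k.+1 n.+1 + z * 'X^((2 * k).+1) * jterm z k.+2 n.
Proof.
rewrite /jterm (qtailS (k + n.+1)) (qinvS n) !addnS !addSn.
set e := qtail _; set v := qinv _.
pose P : {poly R} := 'X^(2 * k * n.+1 + (2 * n.+1 ^ 2 - n.+1)).
pose B : {poly R} := 'X^(2 * n.+1); pose C : {poly R} := 'X^((2 * k).+1).
rewrite (_ : 'X^(2 * k.+1 * n.+1 + _) = P * B); last first.
  by rewrite -exprD; congr ('X^_); nia.
have -> : 'X^((2 * (k + n).+1).+1) = C * B :> {poly R}.
  by rewrite -exprD; congr ('X^_); nia.
apply: eq_subrelation; rewrite -/P -/B -/C.
have eq_exp : C * 'X^(2 * k.+2 * n + (2 * n ^ 2 - n)) = P.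
  by rewrite -exprD; congr ('X^_); nia.
transitivity ((1 + C) * (z ^+ n.+1 * (P * B) * v * e) +
  z * z ^+ n * (C * 'X^(2 * k.+2 * n + (2 * n ^ 2 - n))) * ((1 - B) * v) * e).
  by rewrite eq_exp exprS; ring.
by ring.
Qed.

Definition jsum z (m k : nat) : {poly R} := \sum_(n < m) jterm z k n.

Lemma jsumS z m k : jsum z m.+1 k ~
  (1 + 'X^((2 * k).+1)) * jsum z m.+1 k.+1 + z * 'X^((2 * k).+1) * jsum z m k.+2.
Proof.
rewrite /jsum; elim: m => [|m IHm].
  by rewrite !big_ord_recr !big_ord0 /= mulr0 addr0 !add0r jterm0.
rewrite big_ord_recr /= IHm [in X in _ ~ X]big_ord_recr.
rewrite [in X in _ ~ _ + _ * X]big_ord_recr /= jtermS.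
by apply: eq_subrelation; ring.
Qed.

(** Every term with [n > 0] carries a power of q of exponent at least 2k, so only the term [n = 0]
    survives. *)
Lemma jsum_large z m k : (K <= k)%N -> jsum z m.+1 k ~ 1.
Proof.
move=> le_Kk; rewrite /jsum big_ord_recl.
have jterm_z0 : jterm z k 0 ~ 1.
  by rewrite /jterm muln0 addn0 qtail_large // qinv0 expr0 !mul1r.
rewrite -[X in _ ~ X]addr0; apply: eqmodX_add; first exact: jterm_z0.
transitivity (\sum_(i < m) (0 : {poly R})); last by rewrite big1.
apply: eqmodX_sum => i _.
rewrite /jterm lift0 (@eqmodX_Xn _ _ (_ + _)); last by nia.
by rewrite mulr0 !mul0r.
Qed.

End QSeries.

Section JRecurrence.
Variables (R : comUnitRingType) (N : nat).
Local Notation "p ~ q" := (eqmodX N.+1 p q) (at level 70).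

Lemma jsum_rec (z : {poly R}) k : jsum N.+1 z N.+1 k ~
  (1 + 'X^((2 * k).+1)) * jsum N.+1 z N.+1 k.+1 +
  z * 'X^((2 * k).+1) * jsum N.+1 z N.+1 k.+2.
Proof.
(* Shifting the index leaves the sum at [k.+2] one term short. The missing term, with its factor
   ['X^((2 * k).+1)], has order at least [N.+1]. *)
have top0 : z * 'X^((2 * k).+1) * jterm N.+1 z k.+2 N ~ 0.
  rewrite /jterm; set e := (_ + (2 * N ^ 2 - N))%N.
  rewrite (_ : _ * _ = z ^+ N.+1 * 'X^((2 * k).+1 + e) * qinv R N.+1 N *
     qtail R N.+1 (k.+2 + N)); last by rewrite exprD (exprS z); ring.
  by rewrite (@eqmodX_Xn _ _ (_ + _)) ?mulr0 ?mul0r //; rewrite /e; nia.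
have -> : jsum N.+1 z N.+1 k.+2 = jsum N.+1 z N k.+2 + jterm N.+1 z k.+2 N.
  by rewrite /jsum big_ord_recr.
by rewrite mulrDr top0 addr0 jsumS.
Qed.

End JRecurrence.

(** * The generating polynomials *)

Section GeneratingPolynomial.
Variables (R : comUnitRingType) (x : R).
Local Notation z := ((x ^+ 2 - 1)%:P : {poly R}).

(** The polynomial T_M of the overview. *)
Definition sc_poly (M : nat) : {poly R} :=
  \sum_(s <- sc_le M) x ^+ n1 s *: 'X^(sumn s).

Lemma sc_poly0 : sc_poly 0 = 1.
Proof.
by rewrite /sc_poly big_seq1 /n1 big_ord0 !expr0 scale1r.
Qed.

Lemma sc_polyS M : sc_poly M.+1 = sc_poly M +
  \sum_(s <- sc_le M) x ^+ n1 (add_hook M s) *: 'X^(sumn s + (2 * M).+1).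
Proof.
rewrite /sc_poly [sc_le M.+1]/= big_cat big_map; congr (_ + _).
rewrite !big_seq; apply: eq_bigr => s.
by rewrite mem_sc_le => /andP[_ le_s]; rewrite sumn_add_hook.
Qed.

Lemma sc_poly1 : sc_poly 1 = 1 + x%:P * 'X.
Proof.
rewrite sc_polyS sc_poly0 big_seq1 n1_add_hook //= /n1 big_ord0 mul_polyC.
by rewrite expr1.
Qed.

(** Partitions with exactly [M.+2] parts come from a hook of arm [M.+1] around [s]. If [s] has at
    most [M] parts, two corners appear, giving x^2 T_M; if it has [M.+1] parts, none appears, giving
    T_(M+1) - T_M. *)
Lemma sc_polySS M : sc_poly M.+2 =
  (1 + 'X^((2 * M.+1).+1)) * sc_poly M.+1 +
  z * 'X^((2 * M.+1).+1) * sc_poly M.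
Proof.
rewrite sc_polyS; set w := 'X^((2 * M.+1).+1).
have -> : \sum_(s <- sc_le M.+1)
    x ^+ n1 (add_hook M.+1 s) *: 'X^(sumn s + (2 * M.+1).+1) =
  w * ((x ^+ 2)%:P * sc_poly M + (sc_poly M.+1 - sc_poly M)); last first.
  by rewrite polyCB; ring.
have sumE (N : nat) (F : seq nat -> {poly R}) : \sum_(s <- sc_le N) F s =
    \sum_(s <- sc_le N | self_conjugate s && (size s <= N)%N) F s.
  by rewrite big_seq_cond; apply: eq_bigl => s; rewrite mem_sc_le andbT.
(* The difference T_(M+1) - T_M becomes the sum over [add_hook M s], to match the two halves of
   [sc_le M.+1]. *)
rewrite [X in _ + (X - _)]sc_polyS [X in _ + (X - _)]addrC addrK.
rewrite /sc_poly [sc_le M.+1]/= big_cat big_map mulrDr.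
congr (_ + _).
  rewrite mulrA mulr_sumr !sumE; apply: eq_bigr => s /andP[s_sc le_s].
  rewrite (n1_add_hook s_sc (leqW le_s)) ltnS le_s exprD exprD -!mul_polyC polyCM.
  by rewrite -/w; ring.
rewrite mulr_sumr !sumE; apply: eq_bigr => s /andP[s_sc le_s].
rewrite [in LHS]n1_add_hook ?size_add_hook ?self_conjugate_add_hook //.
rewrite ltnn addn0 sumn_add_hook // exprD -/w -!mul_polyC.
by ring.
Qed.

Variable N : nat.
Local Notation "p ~ q" := (eqmodX N.+1 p q) (at level 70).
Local Notation J := (jsum N.+1 z N.+1).

(** The recurrences for T_(M+2) and J_(M+1) involve the same power [w]; substituting both makes
    consecutive values of the invariant agree identically. *)
Lemma sc_poly_jsum M :
  sc_poly M.+1 * (J M.+1 + z * J M.+2) + z * sc_poly M * (J M.+1 - J M.+2) ~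
  sc_poly 1 * (J 1 + z * J 2) + z * sc_poly 0 * (J 1 - J 2).
Proof.
elim: M => // M <-; rewrite sc_polySS.
set w : {poly R} := 'X^_; rewrite (@jsum_rec R N z M.+1) -/w.
by apply: eq_subrelation; ring.
Qed.

Lemma sc_poly_eq : x \is a GRing.unit ->
  sc_poly N.+1 ~ (1 - x^-1)%:P * J 1 + (x^-1)%:P * J 0.
Proof.
move=> x_unit; have JN : J N.+1 ~ 1 by apply: jsum_large.
have JN1 : J N.+2 ~ 1 by apply/jsum_large/leqW.
have := sc_poly_jsum N; rewrite JN JN1 subrr mulr0 addr0 mulr1 sc_poly0 sc_poly1.
move=> T_eq; pose y : {poly R} := (x^-1)%:P.
have xy : x%:P * y = 1 by rewrite -polyCM divrr.
have zE : z = x%:P ^+ 2 - 1 by rewrite polyCB polyC_exp.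
(* At [M = N] both J factors are 1, so the invariant is T_(N+1) (1 + z) with 1 + z = x^2;
   multiplying by x^(-2) isolates T_(N+1). *)
transitivity (y ^+ 2 * (sc_poly N.+1 * (1 + z))).
  apply: eq_subrelation; rewrite zE.
  rewrite (_ : _ * _ = sc_poly N.+1 * (x%:P * y) ^+ 2); last by ring.
  by rewrite xy expr1n mulr1.
rewrite T_eq (@jsum_rec R N z 0) muln0 expr1; apply: eq_subrelation.
rewrite zE polyCB -/y.
(* At [M = 0] the invariant is x^2 J_1 + x q (J_1 + z J_2), and the recurrence at [k = 0] gives q
   (J_1 + z J_2) = J_0 - J_1. *)
transitivity ((x%:P * y) ^+ 2 * J 1 + y * (x%:P * y) * 'X *
  (J 1 + (x%:P ^+ 2 - 1) * J 2)); first by rewrite zE; ring.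
by rewrite xy zE; ring.
Qed.

(* The two series of the theorem are the cases [c = 1] and [c = 0]. *)
Lemma qtail_suminf (T : nat -> fps R) (c : nat) :
  (forall n, T n =
     fps_div (fps_of_poly ((x ^+ 2 - 1) ^+ n *:
                'X^(2 * c * n + (2 * n ^ 2 - n))))
       (fps_of_poly (qpoch 'X^2 2 n * qpoch (- 'X) 2 (n + c)))) ->
  qtail R N.+1 0 * fps_trunc N.+1 (fps_suminf T) ~ J c.
Proof.
move=> T_eq; pose u n : {poly R} :=
  invX N.+1 (qpoch 'X^2 2 n * qpoch (- 'X) 2 (n + c)).
pose e n := (2 * c * n + (2 * n ^ 2 - n))%N.
have suminf_eq : fps_trunc N.+1 (fps_suminf T) ~
    \sum_(n < N.+1) z ^+ n * 'X^(e n) * u n.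
  move=> i lt_i; rewrite coef_fps_trunc // coef_sum /fps_suminf.
  rewrite (big_ord_widen _ (fun n => T n i) lt_i) big_mkcond.
  apply: eq_bigr => n _; rewrite -polyC_exp mul_polyC.
  rewrite T_eq (coef_fps_div _ _ lt_i) -/(e n) -/(u n).
  (* [fps_suminf] stops at [n = i]; the further terms do not reach coefficient [i], since
     [e n >= n > i]. *)
  case: ltnP => // lt_in; rewrite -scalerAl mulrC coefZ coefMXn.
  by rewrite ifT ?mulr0 // (leq_trans lt_in) // /e; nia.
rewrite suminf_eq mulr_sumr /jsum; apply: eqmodX_sum => n _.
rewrite /jterm -/(e n) mulrCA qtail_invX.
by apply: eq_subrelation; ring.
Qed.

End GeneratingPolynomial.

(** * The identity, coefficient by coefficient *)

Lemma sc_series_sc_poly (x : QX) (N M : nat) : (N <= M)%N ->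
  sc_series x N = (sc_poly x M)`_N.
Proof.
move=> le_NM; rewrite (sc_seriesE x le_NM) /sc_poly coef_sum big_mkcond.
apply: eq_bigr => s _; rewrite coefZ coefXn eq_sym.
by case: eqP => _; rewrite ?mulr1 ?mulr0.
Qed.

Theorem theorem3p1 :
  let x := xvar in
  forall N : nat,
  sc_series x N =
  fps_mul (qpoch_inf (- 'X) 2)
    (fps_add
       (fps_scale (1 - x^-1)
          (fps_suminf (fun n =>
             fps_div (fps_of_poly ((x ^+ 2 - 1) ^+ n *: 'X^(2 * n ^ 2 + n)))
                     (fps_of_poly (qpoch 'X^2 2 n * qpoch (- 'X) 2 n.+1)))))
       (fps_scale x^-1
          (fps_suminf (fun n =>
             fps_div (fps_of_poly ((x ^+ 2 - 1) ^+ n *: 'X^(2 * n ^ 2 - n)))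
                     (fps_of_poly (qpoch 'X^2 2 n * qpoch (- 'X) 2 n))))))
    N.
Proof.
move=> x N; have x_unit : x \is a GRing.unit.
  by rewrite unitfE /x /xvar tofrac_eq0 polyX_eq0.
rewrite (sc_series_sc_poly x (leqnSn N)) (sc_poly_eq x_unit) //.
set T1 := (fun n => _ : fps QX); set T0 := (fun n => _ : fps QX).
have J1 := @qtail_suminf QX x N T1 1; have J0 := @qtail_suminf QX x N T0 0.
rewrite (fps_mul_trunc _ _ (ltnSn N)).
set E := fps_trunc _ (qpoch_inf _ _); set S := fps_trunc _ (fps_add _ _).
have E_eq : eqmodX N.+1 E (qtail QX N.+1 0).
  by move=> i lt_i; rewrite coef_fps_trunc // (@qpoch_inf_qtail QX N.+1).
have S_eq : eqmodX N.+1 S ((1 - x^-1)%:P * fps_trunc N.+1 (fps_suminf T1) +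
                           (x^-1)%:P * fps_trunc N.+1 (fps_suminf T0)).
  by move=> i lt_i; rewrite coefD !coefCM !coef_fps_trunc.
apply: (_ : eqmodX N.+1 _ _) (ltnSn N).
rewrite E_eq S_eq -J1 => [|n]; last first.
  (* For [c = 1] the exponent is 2n + (2n^2 - n) = 2n^2 + n. *)
  rewrite /T1.
  congr (fps_div (fps_of_poly (_ *: 'X^_)) (fps_of_poly (_ * qpoch _ _ _))).
    by nia.
  by rewrite addn1.
rewrite -J0 => [|n]; last by rewrite /T0 muln0 addn0.
by apply: eq_subrelation; ring.
Qed.
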